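(* Let $p\ge1$, $\varepsilon>0$, and let $X\subset\mathbb{R}^d$ be a finite set of points with nonnegative weights $w$. Let $\varphi:X\to\mathbb{R}^m$ be a map (with $\varphi(x)$ carrying weight $w(x)$) whose distortion graph $G$ on $X$ is $\alpha$-everywhere sparse with respect to $w$, where $\alpha\le1/10^{p+1}$. Let $D=(1+\varepsilon)^p(1+3^{p+2}\alpha^{1/(p+1)})$. Then \[\frac1D\,\mathrm{cost}_p(X)\le\mathrm{cost}_p(\varphi(X))\le D\,\mathrm{cost}_p(X).\]
   Context: $\mathrm{cost}_p(X)=\min_{c\in\mathbb{R}^d}\sum_{x\in X}w(x)\|x-c\|^p$ and $\mathrm{cost}_p(\varphi(X))=\min_{c\in\mathbb{R}^m}\sum_{x\in X}w(x)\|\varphi(x)-c\|^p$ (Euclidean norms). The distortion graph of $\varphi$ has vertex set $X$ and an edge between $x,y$ if the distance between $x,y$ is distorted by a factor at least $1+\varepsilon$, i.e. $\|\varphi(x)-\varphi(y)\|$ is not within $[(1+\varepsilon)^{-1}\|x-y\|,(1+\varepsilon)\|x-y\|]$. A vertex-weighted graph $G=(V,E)$ is $\alpha$-everywhere sparse if $\sum_{v\in N(u)}w(v)\le\alpha\sum_{v\in V}w(v)$ for every $u\in V$, where $N(u)$ is the neighborhood of $u$. *)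

(* Defs.v *)
From HB Require Import structures.
From mathcomp Require Import all_boot all_order all_algebra finmap.
From mathcomp Require Import all_classical all_reals all_analysis.

Set Implicit Arguments.
Unset Strict Implicit.
Unset Printing Implicit Defensive.

Import Order.TTheory GRing.Theory Num.Theory.
Import numFieldNormedType.Exports.

Local Open Scope classical_set_scope.
Local Open Scope ring_scope.

(* The library norm `|v| on 'rV[R]_n is the sup norm, hence this definition. *)
Definition enorm (R : realType) (n : nat) (v : 'rV[R]_n) : R :=
  Num.sqrt (\sum_(i < n) v ord0 i ^+ 2).

(* A weighted point set is given by an indexing x : T -> 'rV[R]_n, so that
   the points of an image phi(X) are counted with multiplicity. *)
Definition cost_at (R : realType) (T : finType) (n : nat) (p : R)
    (w : T -> R) (x : T -> 'rV[R]_n) (c : 'rV[R]_n) : R :=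
  \sum_(t : T) w t * enorm (x t - c) `^ p.

(* The infimum is a minimum for nonnegative weights: see cost_attained. *)
Definition cost (R : realType) (T : finType) (n : nat) (p : R)
    (w : T -> R) (x : T -> 'rV[R]_n) : R :=
  inf (range (cost_at p w x)).

Definition distortion_graph (R : realType) (T : finType) (d m : nat) (eps : R)
    (x : T -> 'rV[R]_d) (y : T -> 'rV[R]_m) : rel T :=
  fun s t =>
    ~~ ((1 + eps)^-1 * enorm (x s - x t) <= enorm (y s - y t)
        <= (1 + eps) * enorm (x s - x t)).

Definition everywhere_sparse (R : realType) (V : finType) (w : V -> R)
    (alpha : R) (E : rel V) : Prop :=
  forall u : V, \sum_(v | E u v) w v <= alpha * \sum_v w v.

Section CostAttained.
Variable R : realType.

Lemma enorm_ge0 n (v : 'rV[R]_n) : 0 <= enorm v.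
Proof. exact: sqrtr_ge0. Qed.

Lemma coord_le_enorm n (v : 'rV[R]_n) i : `|v ord0 i| <= enorm v.
Proof.
rewrite -sqrtr_sqr /enorm; apply: ler_wsqrtr.
by rewrite (bigD1 i)//= lerDl sumr_ge0// => j _; exact: sqr_ge0.
Qed.

Lemma norm_le_enorm n (v : 'rV[R]_n) : `|v| <= enorm v.
Proof.
have [->|v0] := eqVneq (`|v|) 0; first exact: enorm_ge0.
have [[i j] /= vij] := mx_norm_neq0 v0.
rewrite [leLHS]vij.
by rewrite (ord1 i); exact: coord_le_enorm.
Qed.

Lemma enorm_continuous n : continuous (@enorm R n).
Proof.
move=> v; apply: (@continuous_comp _ _ _
  (fun v : 'rV[R]_n => \sum_(i < n) v ord0 i ^+ 2) (@Num.sqrt R));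
  last exact: sqrt_continuous.
apply: cvg_big => [||i _]; [exact: add_continuous|exact: nbhs_filter|].
apply: (@continuous_comp _ _ _ (fun v : 'rV[R]_n => v ord0 i) (fun y => y ^+ 2)).
  exact: coord_continuous.
exact: exprn_continuous.
Qed.

Lemma cvg_powR_ge0 (p a : R) : 1 <= p -> 0 <= a ->
  `|y| `^ p @[y --> a] --> a `^ p.
Proof.
move=> p1; rewrite le_eqVlt => /predU1P[<-|a0].
  rewrite powR0; last by rewrite gt_eqF// (lt_le_trans _ p1).
  apply: (@squeeze_cvgr _ _ _ _ (fun=> 0) (fun y : R => `|y|)).
  - near=> y; rewrite powR_ge0/=.
    have y1 : `|y| <= 1.
      near: y; apply/nbhs_ballP; exists 1 => //= y.
      by rewrite /ball/= sub0r normrN => /ltW.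
    have [->|y0] := eqVneq y 0.
      by rewrite normr0 powR0// gt_eqF// (lt_le_trans _ p1).
    rewrite -[leRHS]powRr1//; apply: ger_powR => //.
    by rewrite y1 normr_gt0 y0.
  - exact: cvg_cst.
  - rewrite -[X in _ --> X](@normr0 _ R); exact: norm_continuous.
rewrite -{2}(gtr0_norm a0).
apply: (@continuous_comp _ _ _ (fun y : R => `|y|) (fun y => y `^ p)).
  exact: norm_continuous.
apply: differentiable_continuous; apply/derivable1_diffP.
by apply: derivable_powR; rewrite in_itv/= andbT gtr0_norm.
Unshelve. all: by end_near. Qed.

Lemma enorm_sub_continuous n (x : 'rV[R]_n) :
  continuous (fun c : 'rV[R]_n => enorm (x - c)).
Proof.
move=> c; apply: (@continuous_comp _ _ _ (fun y : 'rV[R]_n => x - y) (@enorm R n)).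
  apply: (@continuousB R 'rV[R]_n _ (fun=> x) id) => //; exact: cst_continuous.
exact: enorm_continuous.
Qed.

Lemma enorm_powR_continuous n p (x : 'rV[R]_n) : 1 <= p ->
  continuous (fun c : 'rV[R]_n => enorm (x - c) `^ p).
Proof.
move=> p1 c.
have -> : (fun c : 'rV[R]_n => enorm (x - c) `^ p) =
    (fun y : R => `|y| `^ p) \o (fun c => enorm (x - c)).
  by apply/funext => y /=; rewrite ger0_norm// enorm_ge0.
apply: continuous_comp; first exact: enorm_sub_continuous.
have := cvg_powR_ge0 p1 (enorm_ge0 (x - c)).
by rewrite -{2}(ger0_norm (enorm_ge0 (x - c))).
Qed.

Lemma cost_at_continuous (T : finType) n p (w : T -> R) (x : T -> 'rV[R]_n) :
  1 <= p -> continuous (cost_at p w x).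
Proof.
move=> p1.
have cF t : continuous (fun c : 'rV[R]_n => w t * enorm (x t - c) `^ p).
  move=> c; apply: (@continuous_comp _ _ _
    (fun c : 'rV[R]_n => enorm (x t - c) `^ p) ( *%R (w t))).
    exact: enorm_powR_continuous.
  exact: mulrl_continuous.
by apply: continuous_big => [|t _]; [exact: add_continuous|exact: cF].
Qed.

Lemma cost_attained (T : finType) n p (w : T -> R) (x : T -> 'rV[R]_n) :
  1 <= p -> (forall t, 0 <= w t) ->
  exists2 c, cost p w x = cost_at p w x c
           & forall c', cost_at p w x c <= cost_at p w x c'.
Proof.
move=> p1 w0; set f := cost_at p w x.
suff [c fc] : exists c, forall c', f c <= f c'.
  exists c => //; apply/eqP; rewrite eq_le; apply/andP; split.
    apply: ge_inf; last by exists c.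
    by exists (f c) => _ [c' _ <-].
  apply: lb_le_inf; first by exists (f c); exists c.
  by move=> _ [c' _ <-].
have term_ge0 c t : 0 <= w t * enorm (x t - c) `^ p by rewrite mulr_ge0// powR_ge0.
have [/existsP[t0 wt0]|] := boolP [exists t, 0 < w t]; last first.
  rewrite negb_exists => /forallP wle0.
  have wz t : w t = 0 by apply/eqP; rewrite eq_le w0 leNgt wle0.
  by exists 0 => c'; rewrite /f /cost_at !big1// => t _; rewrite wz mul0r.
pose A := [set c | f c <= f 0].
have cf : continuous f by exact: cost_at_continuous.
have clA : closed A.
  by apply: (@closed_comp _ _ f [set y | y <= f 0]) => [? _|]; [exact: cf|exact: closed_le].
have bA : bounded_set A.
  pose M := `|x t0| + (1 + f 0 / w t0).
  have MA c : A c -> `|c| <= M.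
    move=> Ac; rewrite -[c](subKr (x t0)) (le_trans (ler_normB _ _))// lerD2l.
    apply: le_trans (norm_le_enorm _) _.
    have h : enorm (x t0 - c) `^ p <= f 0 / w t0.
      rewrite ler_pdivlMr// mulrC; apply: le_trans Ac.
      by rewrite /f /cost_at (bigD1 t0)//= lerDl sumr_ge0.
    have [le1|gt1] := leP (enorm (x t0 - c)) 1.
      by rewrite (le_trans le1)// lerDl (le_trans (powR_ge0 _ _) h).
    apply: le_trans (_ : f 0 / w t0 <= _); last by rewrite lerDr.
    apply: le_trans h; rewrite -[leLHS]powRr1 ?enorm_ge0//.
    by apply: ler_powR => //; exact: ltW.
  exists M; split; first exact: num_real.
  by move=> y My c /MA /le_trans; apply; exact: ltW.
have A0 : A !=set0 by exists 0; rewrite /A/=.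
have [c cA fc] := compact_EVT_min A0 (bounded_closed_compact bA clA)
  (continuous_subspaceT cf).
exists c => c'; have [c'A|/ltW c'A] := leP (f c') (f 0); first by apply: fc; rewrite inE.
by apply: le_trans c'A; apply: fc; rewrite inE /A/=.
Qed.

End CostAttained.

(* Main.v *)
Require Import Defs.
From HB Require Import structures.
From mathcomp Require Import all_boot all_order all_algebra finmap.
From mathcomp Require Import all_classical all_reals all_analysis.
From mathcomp Require Import ring lra.

Set Implicit Arguments.
Unset Strict Implicit.
Unset Printing Implicit Defensive.

Import Order.TTheory GRing.Theory Num.Theory.
Import numFieldNormedType.Exports.

Local Open Scope classical_set_scope.
Local Open Scope ring_scope.

(** Up to exchanging [X] and [phi(X)] only the upper bound is needed. Fix a center
    [c] of [X] and put [r t = |x t - c|], [L = 1 + eps], [th = alpha^(1/(p+1))], so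
    that [alpha = th * th^p]. A robust form of Kirszbraun's one-point extension gives
    [c'] with [|y t - c'|^2 <= L^2 (1 + 8 th) (r t)^2] outside a set of weight
    [O(th^p W)], where [W] is the total weight. By minimax duality such a [c'] exists
    as soon as, for every distribution [l <= w / (th^p W)] avoiding a central set of
    weight [O(alpha W)], the variance of [y] is at most the [l]-mean of the right-hand
    side. Variances are averages of squared pairwise distances; under [l] the
    distorted neighbours of a vertex have mass at most [alpha / th^p = th], and across
    a distorted edge between non-central points the distance is controlled by passing
    through a common undistorted neighbour that is closer to [c].

    An exceptional [t] is linked to an unexceptional [u] by an undistorted pair, with
    [(r u)^p] at most twice the average, whence [|y t - c'| <= L (r t + 3 r u)]. The
    exceptional weight being [O(th^p W)], convexity of the [p]-th power limits the
    effect of these points on the cost to a factor [1 + O(3^p th)]. *)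

Section EuclideanNorm.
Variables (R : realType) (n : nat).
Implicit Types (u v z : 'rV[R]_n) (k : R).

Definition edot u v : R := \sum_(i < n) u ord0 i * v ord0 i.

Lemma enorm_sqr v : enorm v ^+ 2 = \sum_(i < n) v ord0 i ^+ 2.
Proof. by rewrite sqr_sqrtr// sumr_ge0// => i _; exact: sqr_ge0. Qed.

Lemma enormZ k v : enorm (k *: v) = `|k| * enorm v.
Proof.
rewrite /enorm; under eq_bigr do rewrite mxE exprMn.
by rewrite -mulr_sumr sqrtrM ?sqr_ge0// sqrtr_sqr.
Qed.

Lemma enorm_distC u v : enorm (u - v) = enorm (v - u).
Proof. by rewrite -opprB -scaleN1r enormZ normrN1 mul1r. Qed.

Lemma sqr_enormD u v :
  enorm (u + v) ^+ 2 = enorm u ^+ 2 + edot u v *+ 2 + enorm v ^+ 2.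
Proof.
rewrite !enorm_sqr -sumrMnl -!big_split/=.
by apply: eq_bigr => i _; rewrite mxE sqrrD.
Qed.

Lemma lagrange_identity u v :
  \sum_i \sum_j (u ord0 i * v ord0 j - u ord0 j * v ord0 i) ^+ 2 =
  2 * (enorm u ^+ 2 * enorm v ^+ 2 - edot u v ^+ 2).
Proof.
rewrite mulrBr mulr_natl mulr2n {2}[_ ^+ 2 * _]mulrC !enorm_sqr expr2.
rewrite /edot !big_distrlr/= mulr_sumr -big_split -sumrB/=.
apply: eq_bigr => i _; rewrite mulr_sumr -big_split -sumrB/=.
by apply: eq_bigr => j _; ring.
Qed.

Lemma enorm_cauchy_schwarz u v : edot u v <= enorm u * enorm v.
Proof.
apply: le_trans (ler_norm _) _.
rewrite -(@ler_pXn2r _ 2)// ?nnegrE ?mulr_ge0 ?enorm_ge0//.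
rewrite exprMn real_normK ?num_real// -subr_ge0 -(pmulr_rge0 _ (@ltr0n R 2)).
rewrite -lagrange_identity; apply: sumr_ge0 => i _.
by apply: sumr_ge0 => j _; exact: sqr_ge0.
Qed.

Lemma ler_enormD u v : enorm (u + v) <= enorm u + enorm v.
Proof.
rewrite -(@ler_pXn2r _ 2)// ?nnegrE ?addr_ge0 ?enorm_ge0//.
by rewrite sqr_enormD sqrrD lerD2r lerD2l lerMn2r enorm_cauchy_schwarz orbT.
Qed.

Lemma ler_enorm_distD v u z : enorm (u - z) <= enorm (u - v) + enorm (v - z).
Proof. by rewrite -{1}(subrKA v); exact: ler_enormD. Qed.

End EuclideanNorm.

Section WeightedMean.
Variables (R : realType) (T : finType) (n : nat).
Implicit Types (l : T -> R) (y : T -> 'rV[R]_n) (c : 'rV[R]_n).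

Definition wmean l y : 'rV[R]_n := \sum_t l t *: y t.

Definition wvariance l y : R := \sum_t l t * enorm (y t - wmean l y) ^+ 2.

Lemma wmean_coord l y i : wmean l y ord0 i = \sum_t l t * y t ord0 i.
Proof. by rewrite summxE; apply: eq_bigr => t _; rewrite mxE. Qed.

Lemma wmean_segment l l' y e :
  wmean (fun t => l t + e * (l' t - l t)) y - wmean l y =
  e *: (wmean l' y - wmean l y).
Proof.
rewrite /wmean -!sumrB scaler_sumr; apply: eq_bigr => t _.
by rewrite -!scalerBl scalerA; congr (_ *: _); ring.
Qed.

Lemma parallel_axis l y c : \sum_t l t = 1 ->
  \sum_t l t * enorm (y t - c) ^+ 2 = wvariance l y + enorm (wmean l y - c) ^+ 2.
Proof.
move=> l1.
have sqdistE b : \sum_t l t * enorm (y t - b) ^+ 2 =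
    \sum_i (\sum_t l t * y t ord0 i ^+ 2 -
            (b ord0 i * wmean l y ord0 i) *+ 2 + b ord0 i ^+ 2).
  under eq_bigr do rewrite enorm_sqr mulr_sumr.
  rewrite exchange_big/=; apply: eq_bigr => i _.
  rewrite wmean_coord -[X in _ + X]mulr1 -l1 !mulr_sumr -sumrMnl -sumrB -big_split/=.
  by apply: eq_bigr => t _; rewrite !mxE; ring.
rewrite /wvariance !sqdistE enorm_sqr -big_split/=.
by apply: eq_bigr => i _; rewrite !mxE; ring.
Qed.

Lemma wvariance_le l y c : \sum_t l t = 1 ->
  wvariance l y <= \sum_t l t * enorm (y t - c) ^+ 2.
Proof. by move=> l1; rewrite (parallel_axis _ _ l1) lerDl sqr_ge0. Qed.

Lemma wvariance_pairwise l y : \sum_t l t = 1 ->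
  \sum_s \sum_t l s * l t * enorm (y s - y t) ^+ 2 = 2 * wvariance l y.
Proof.
move=> l1; rewrite mulr_natl mulr2n -{1}[wvariance l y]mul1r -l1 mulr_suml.
rewrite -big_split/=; apply: eq_bigr => s _.
rewrite enorm_distC -mulrDr -parallel_axis// mulr_sumr.
by apply: eq_bigr => t _; rewrite enorm_distC mulrA.
Qed.

Lemma wvariance_segment l l' y e : \sum_t l t = 1 -> \sum_t l' t = 1 ->
  wvariance (fun t => l t + e * (l' t - l t)) y =
  wvariance l y + e * (\sum_t l' t * enorm (y t - wmean l y) ^+ 2 - wvariance l y) -
  e ^+ 2 * enorm (wmean l' y - wmean l y) ^+ 2.
Proof.
move=> l1 l'1; set h := fun t => _.
have h1 : \sum_t h t = 1 by rewrite big_split/= -mulr_sumr sumrB l1 l'1; ring.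
have /eqP := parallel_axis y (wmean l y) h1.
rewrite wmean_segment enormZ exprMn real_normK ?num_real// -subr_eq => /eqP <-.
congr (_ - _); rewrite /wvariance -sumrB mulr_sumr -big_split/=.
by apply: eq_bigr => t _; rewrite /h; ring.
Qed.

Lemma eval_continuous t : continuous (fun l : {ptws T -> R} => l t).
Proof. exact: (@proj_continuous _ (fun=> R) t). Qed.

Lemma wvariance_continuous y : continuous (fun l : {ptws T -> R} => wvariance l y).
Proof.
have wmean_cont : continuous (fun l : {ptws T -> R} => wmean l y).
  apply: continuous_big => [|t _ l]; first exact: add_continuous.
  by apply: continuousZ; [exact: eval_continuous|exact: cst_continuous].
apply: continuous_big => [|t _ l]; first exact: add_continuous.
apply: (@continuousM R _ (fun l : {ptws T -> R} => l t)); first exact: eval_continuous.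
apply: (@continuous_comp _ _ _ (fun l : {ptws T -> R} => wmean l y)
  (fun c => enorm (y t - c) ^+ 2)); first exact: wmean_cont.
apply: (@continuous_comp _ _ _ (fun c => enorm (y t - c)) (fun a => a ^+ 2)).
  exact: enorm_sub_continuous.
exact: exprn_continuous.
Qed.

End WeightedMean.

Section CappedDistribution.
Variables (R : realType) (T : finType).
Implicit Types (u l k : T -> R).

Definition capped_distribution u l : Prop :=
  (forall t, 0 <= l t <= u t) /\ \sum_t l t = 1.

Lemma capped_distribution_segment u l l' e : 0 <= e <= 1 ->
  capped_distribution u l -> capped_distribution u l' ->
  capped_distribution u (fun t => l t + e * (l' t - l t)).
Proof.
move=> /andP[e0 e1] [lu l1] [l'u l'1]; split=> [t|].
  by have /andP[? ?] := lu t; have /andP[? ?] := l'u t; apply/andP; split; nra.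
by rewrite big_split/= -mulr_sumr sumrB l1 l'1 subrr mulr0 addr0.
Qed.

Lemma capped_distribution_compact u :
  compact [set l : {ptws T -> R} | capped_distribution u l].
Proof.
have -> : [set l : {ptws T -> R} | capped_distribution u l] =
    [set l | forall t, `[0, u t]%classic (l t)] `&`
    (fun l : {ptws T -> R} => \sum_t l t) @^-1` [set 1].
  by apply/seteqP; split=> l [lu l1]; split=> // t; have := lu t; rewrite /= in_itv.
apply: compact_closedI.
  apply: (@tychonoff _ (fun=> R) (fun t => `[0, u t]%classic)) => t.
  exact: segment_compact.
apply: preimage_closed; last exact: closed_eq.
move=> l _; apply: continuous_big => [|t _]; first exact: add_continuous.
exact: eval_continuous.
Qed.

Lemma exists_wvariance_maximizer u k n (y : T -> 'rV[R]_n) l0 :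
  capped_distribution u l0 ->
  exists2 l, capped_distribution u l & forall l', capped_distribution u l' ->
    wvariance l' y - \sum_t l' t * k t <= wvariance l y - \sum_t l t * k t.
Proof.
move=> l0u; pose f (l : {ptws T -> R}) := wvariance l y - \sum_t l t * k t.
have f_cont : continuous f.
  move=> l; apply: continuousB; first exact: wvariance_continuous.
  move: l; apply: continuous_big => [|t _ l]; first exact: add_continuous.
  by apply: (@continuousM R _ (fun l : {ptws T -> R} => l t) (fun=> k t));
    [exact: eval_continuous|exact: cst_continuous].
have [|l lu lmax] := compact_EVT_max _ (@capped_distribution_compact u)
  (continuous_subspaceT f_cont); first by exists l0.
by exists l => [|l' l'u]; [rewrite inE in lu|apply: lmax; rewrite inE].
Qed.

End CappedDistribution.

Section Weight.
Variables (R : realType) (T : finType) (w : T -> R).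
Hypothesis w_ge0 : forall t, 0 <= w t.
Implicit Types (P Q : pred T) (r : T -> R).

Definition weight P : R := \sum_(t | P t) w t.

Lemma weight_ge0 P : 0 <= weight P.
Proof. by apply: sumr_ge0 => t _; exact: w_ge0. Qed.

Lemma le_weight P Q : (forall t, P t -> Q t) -> weight P <= weight Q.
Proof.
move=> PQ; rewrite /weight big_mkcond [leRHS]big_mkcond/=; apply: ler_sum => t _.
by case: ifP => [/PQ ->//|_]; case: ifP.
Qed.

Lemma weightU P Q : weight (predU P Q) <= weight P + weight Q.
Proof.
rewrite /weight (bigID P)/= lerD//; last by apply: le_weight => t /andP[/orP[->|]].
by apply: le_weight => t /andP[].
Qed.

Lemma weightC P : weight P + weight (predC P) = weight predT.
Proof. by rewrite /weight [RHS](bigID P). Qed.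

Lemma lt_weight_ex P Q : weight Q < weight P -> exists2 t, P t & ~~ Q t.
Proof.
apply: contraPP => noPQ; apply/negP; rewrite -leNgt; apply: le_weight => t Pt.
by apply/negP => /negP Qt; apply: noPQ; exists t.
Qed.

Lemma everywhere_sparse_ge0 (E : rel T) alpha :
  0 < weight predT -> everywhere_sparse w alpha E -> 0 <= alpha.
Proof.
move=> W_gt0 sparse.
have [t _|T0] := pickP (@predT T); last by rewrite /weight big_pred0 ?ltxx in W_gt0.
by have := le_trans (weight_ge0 (E t)) (sparse t); rewrite pmulr_lge0.
Qed.

Lemma everywhere_sparse_le (E : rel T) alpha alpha' :
  alpha <= alpha' -> everywhere_sparse w alpha E -> everywhere_sparse w alpha' E.
Proof.
move=> alpha_le sparse u; apply: le_trans (sparse u) _.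
by rewrite ler_wpM2r//; exact: (weight_ge0 predT).
Qed.

Definition lower_tail r (a : R) : pred T := fun t => weight (fun s => r s <= r t) <= a.

Lemma weight_lower_tail r a : 0 <= a -> weight (lower_tail r a) <= a.
Proof.
move=> a0; have [t0 tail_t0|tail0] := pickP (lower_tail r a); last first.
  by rewrite /weight big_pred0.
have [t tail_t tmax] := @arg_maxP _ _ _ t0 (lower_tail r a) r tail_t0.
by apply: le_trans tail_t; apply: le_weight => s /tmax.
Qed.

Lemma le_average_ex P (f : T -> R) (M : R) : (forall t, 0 <= f t) ->
  0 < M <= weight P -> exists2 t, P t & f t <= (\sum_t w t * f t) / M.
Proof.
move=> f_ge0 /andP[M_gt0 MP]; have [t0 Pt0|P0] := pickP P; last first.
  by move: MP; rewrite /weight big_pred0// leNgt M_gt0.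
have [t Pt tmin] := @arg_minP _ _ _ t0 P f Pt0.
exists t => //; rewrite ler_pdivlMr//; apply: (le_trans (ler_wpM2l (f_ge0 t) MP)).
rewrite mulr_sumr big_mkcond/=; apply: ler_sum => s _.
case: ifP => [Ps|_]; last by rewrite mulr_ge0.
by rewrite mulrC ler_wpM2l// tmin.
Qed.

Definition conditional P : T -> R := fun t => if P t then w t / weight P else 0.

Lemma conditional_ge0 P t : 0 <= conditional P t.
Proof. by rewrite /conditional; case: ifP => // _; rewrite divr_ge0// weight_ge0. Qed.

Lemma conditional_sum P : 0 < weight P -> \sum_t conditional P t = 1.
Proof. by move=> P_gt0; rewrite -big_mkcond/= -mulr_suml divff// gt_eqF. Qed.

Lemma conditional_mean_gt0 P (f : T -> R) : 0 < weight P ->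
  (forall t, P t -> 0 < f t) -> 0 < \sum_t conditional P t * f t.
Proof.
move=> P_gt0 f_gt0.
have term_ge0 t : 0 <= conditional P t * f t.
  have [/f_gt0/ltW Pt|Pt] := boolP (P t); first by rewrite mulr_ge0// conditional_ge0.
  by rewrite /conditional (negbTE Pt) mul0r.
rewrite lt_neqAle sumr_ge0// andbT eq_sym; apply/eqP => sum0.
have := @oner_neq0 R; rewrite -(conditional_sum P_gt0) big1 ?eqxx// => t _.
have /eqP : conditional P t * f t = 0 by apply: psumr_eq0P sum0 _ _ => //.
rewrite mulf_eq0 => /orP[/eqP//|]; rewrite /conditional; case: ifP => // Pt.
by rewrite gt_eqF ?f_gt0.
Qed.

Lemma conditional_capped P : 1 <= weight P -> capped_distribution w (conditional P).
Proof.
move=> P_ge1; have P_gt0 := lt_le_trans ltr01 P_ge1.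
split=> [t|]; last exact: conditional_sum.
rewrite conditional_ge0//= /conditional; case: ifP => // _.
by rewrite ler_piMr// invf_le1.
Qed.

End Weight.

Lemma ler_small_perturbation (R : realFieldType) (a b k M : R) :
  0 < M -> (forall e, 0 < e <= M -> a <= b + e * k) -> a <= b.
Proof.
move=> M_gt0 ab; apply/ler_addgt0Pr => d d_gt0.
have k1_gt0 : 0 < `|k| + 1 by rewrite ltr_wpDl.
pose e := Num.min M (d / (`|k| + 1)).
have e_gt0 : 0 < e by rewrite lt_min M_gt0 divr_gt0.
apply: (le_trans (ab e _)); first by rewrite e_gt0 ge_min lexx.
have ed : e * (`|k| + 1) <= d by rewrite -ler_pdivlMr// ge_min lexx orbT.
rewrite lerD2l; apply: le_trans ed; rewrite ler_pM2l//.
by apply: le_trans (ler_norm _) _; rewrite lerDl ler01.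
Qed.

Section RobustCenter.
Variables (R : realType) (T : finType) (n : nat).
Variables (y : T -> 'rV[R]_n) (u k : T -> R).

Lemma wvariance_maximizer_variational l l' :
  capped_distribution u l -> capped_distribution u l' ->
  (forall h, capped_distribution u h ->
    wvariance h y - \sum_t h t * k t <= wvariance l y - \sum_t l t * k t) ->
  \sum_t l' t * (enorm (y t - wmean l y) ^+ 2 - k t) <=
  wvariance l y - \sum_t l t * k t.
Proof.
move=> lu l'u lmax.
apply: (ler_small_perturbation (k := enorm (wmean l' y - wmean l y) ^+ 2) ltr01).
move=> e /andP[e_gt0 e_le1].
have e01 : 0 <= e <= 1 by rewrite ltW.
have := lmax _ (capped_distribution_segment e01 lu l'u).
rewrite wvariance_segment; [|exact: lu.2|exact: l'u.2].
under [X in _ - X <= _]eq_bigr do rewrite mulrDl -mulrA mulrBl.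
rewrite big_split/= -mulr_sumr sumrB.
under [X in _ -> X <= _]eq_bigr do rewrite mulrBr.
by rewrite sumrB => perturbed; rewrite -(ler_pM2l e_gt0); lra.
Qed.

(* The center is the mean of [y] under a capped distribution [l] maximising
   [wvariance l y - \sum_t l t * k t]: if the violating points had [u]-weight above 1,
   moving [l] towards [u] conditioned on them would increase this objective. *)
Lemma exists_robust_center : (forall t, 0 <= u t) ->
  (forall l, capped_distribution u l -> wvariance l y <= \sum_t l t * k t) ->
  exists c, weight u (fun t => k t < enorm (y t - c) ^+ 2) <= 1.
Proof.
move=> u_ge0 var_le; have [u_lt1|u_ge1] := ltP (weight u predT) 1.
  by exists 0; apply: le_trans (ltW u_lt1); exact: le_weight.
have [l lu lmax] := exists_wvariance_maximizer k y (conditional_capped u_ge0 u_ge1).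
exists (wmean l y); set V := fun t => _; rewrite leNgt; apply/negP => V_gt1.
have := wvariance_maximizer_variational lu (conditional_capped u_ge0 (ltW V_gt1)) lmax.
apply/negP; rewrite -ltNge (@le_lt_trans _ _ 0)// ?subr_le0 ?var_le//.
by apply: conditional_mean_gt0 => [//||t]; [exact: lt_trans V_gt1|rewrite subr_gt0].
Qed.

End RobustCenter.

Definition lipschitz_off (R : realType) (T : finType) (d m : nat) (E : rel T) (L : R)
    (x : T -> 'rV[R]_d) (y : T -> 'rV[R]_m) : Prop :=
  forall s t, ~~ E s t -> enorm (y s - y t) <= L * enorm (x s - x t).

Section RobustExtension.
Variables (R : realType) (T : finType) (d m : nat).
Variables (x : T -> 'rV[R]_d) (y : T -> 'rV[R]_m) (E : rel T).
Hypothesis E_sym : symmetric E.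

Lemma wvariance_le_sparse (l a : T -> R) (K delta : R) :
  (forall t, 0 <= l t) -> \sum_t l t = 1 -> (forall t, 0 <= a t) ->
  (forall s, weight l (E s) <= delta) ->
  (forall s t, 0 < l s -> 0 < l t -> enorm (y s - y t) ^+ 2 <=
     K * enorm (x s - x t) ^+ 2 + (E s t)%:R * (a s + a t)) ->
  wvariance l y <= K * wvariance l x + delta * \sum_t l t * a t.
Proof.
move=> l_ge0 l1 a_ge0 degree dist_le.
pose cross s t := (E s t)%:R * l t * (l s * a s).
have cross_sum : \sum_s \sum_t cross s t <= delta * \sum_t l t * a t.
  rewrite mulr_sumr; apply: ler_sum => s _.
  rewrite -mulr_suml ler_wpM2r ?mulr_ge0//.
  apply: le_trans (degree s); rewrite /weight [leRHS]big_mkcond/=.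
  by apply: ler_sum => t _; case: (E s t); rewrite ?mul1r ?mul0r.
have pair_le s t : l s * l t * enorm (y s - y t) ^+ 2 <=
    K * (l s * l t * enorm (x s - x t) ^+ 2) + (cross s t + cross t s).
  have [ls0|ls_neq0] := eqVneq (l s) 0; first by rewrite /cross ls0; lra.
  have [lt0|lt_neq0] := eqVneq (l t) 0; first by rewrite /cross lt0; lra.
  have ls_gt0 : 0 < l s by rewrite lt_def ls_neq0 l_ge0.
  have lt_gt0 : 0 < l t by rewrite lt_def lt_neq0 l_ge0.
  rewrite /cross (E_sym t s).
  by have := ler_wpM2l (ltW (mulr_gt0 ls_gt0 lt_gt0)) (dist_le s t ls_gt0 lt_gt0); lra.
rewrite -(ler_pM2l (ltr0n R 2)) -wvariance_pairwise// mulrDr mulrCA.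
rewrite -wvariance_pairwise//.
apply: (@le_trans _ _ (K * (\sum_s \sum_t l s * l t * enorm (x s - x t) ^+ 2) +
    (\sum_s \sum_t cross s t + \sum_s \sum_t cross t s))).
  rewrite mulr_sumr -!big_split/=; apply: ler_sum => s _.
  by rewrite mulr_sumr -!big_split/=; apply: ler_sum => t _; exact: pair_le.
by rewrite lerD2l [X in _ + X]exchange_big/=; lra.
Qed.

Variables (w : T -> R) (c : 'rV[R]_d) (L alpha beta : R).
Hypotheses (w_ge0 : forall t, 0 <= w t) (W_gt0 : 0 < weight w predT).
Hypotheses (L_ge0 : 0 <= L) (beta_gt0 : 0 < beta).
Hypothesis E_sparse : everywhere_sparse w alpha E.
Hypothesis y_lipschitz : lipschitz_off E L x y.

Let W : R := weight w predT.
Let r (t : T) : R := enorm (x t - c).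
Let r_ge0 t : 0 <= r t. Proof. exact: enorm_ge0. Qed.
Let alpha_ge0 : 0 <= alpha. Proof. exact: everywhere_sparse_ge0 E_sparse. Qed.

Let central : pred T := lower_tail w r (2 * alpha * W).

(* The neighbours of [s] and [t] together weigh at most [2 * alpha * W], so two
   non-central points have a common non-neighbour no farther from [c] than either. *)
Lemma noncentral_dist_le s t : ~~ central s -> ~~ central t ->
  enorm (y s - y t) <= 2 * L * (r s + r t).
Proof.
wlog st : s t / r s <= r t => [sym|] sN tN.
  have [st|/ltW ts] := leP (r s) (r t); first exact: sym.
  by rewrite enorm_distC (addrC (r s)); exact: sym.
have [u us] : exists2 u, r u <= r s & ~~ (E s u || E t u).
  apply: (lt_weight_ex w_ge0); apply: (@le_lt_trans _ _ (2 * alpha * W)).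
    apply: le_trans (weightU w_ge0 (E s) (E t)) _.
    by rewrite -mulrA mulr_natl mulr2n lerD//; exact: E_sparse.
  by rewrite ltNge.
rewrite negb_or => /andP[/y_lipschitz su /y_lipschitz tu].
have x_dist v : enorm (x v - x u) <= r v + r u.
  by rewrite /r (enorm_distC (x u)); exact: ler_enorm_distD.
have := ler_enorm_distD (y u) (y s) (y t); rewrite (enorm_distC (y u)).
have := ler_wpM2l L_ge0 (x_dist s); have := ler_wpM2l L_ge0 (x_dist t).
by have := ler_wpM2l L_ge0 us; have := ler_wpM2l L_ge0 st; lra.
Qed.

Lemma noncentral_sqdist_le s t : ~~ central s -> ~~ central t ->
  enorm (y s - y t) ^+ 2 <= L ^+ 2 * enorm (x s - x t) ^+ 2 +
    (E s t)%:R * (8 * L ^+ 2 * r s ^+ 2 + 8 * L ^+ 2 * r t ^+ 2).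
Proof.
move=> sN tN; have [st|/y_lipschitz st] := boolP (E s t); last first.
  by rewrite mul0r addr0 -exprMn ler_pXn2r// nnegrE ?mulr_ge0 ?enorm_ge0.
rewrite mul1r (@le_trans _ _ ((2 * L * (r s + r t)) ^+ 2))//.
  by rewrite ler_pXn2r ?nnegrE ?mulr_ge0 ?addr_ge0 ?enorm_ge0 ?noncentral_dist_le.
have := mulr_ge0 (sqr_ge0 L) (sqr_ge0 (r s - r t)).
by have := mulr_ge0 (sqr_ge0 L) (sqr_ge0 (enorm (x s - x t))); lra.
Qed.

Let cap (t : T) : R := if central t then 0 else w t / (beta * W).

Lemma capped_wvariance_le l : capped_distribution cap l ->
  wvariance l y <= \sum_t l t * (L ^+ 2 * (1 + 8 * (alpha / beta)) * r t ^+ 2).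
Proof.
move=> [l_cap l1].
have l_ge0 t : 0 <= l t by case/andP: (l_cap t).
have noncentral t : 0 < l t -> ~~ central t.
  by apply: contraTN => tc; case/andP: (l_cap t) => _; rewrite /cap tc leNgt.
have degree s : weight l (E s) <= alpha / beta.
  apply: (@le_trans _ _ (\sum_(t | E s t) w t / (beta * W))).
    apply: ler_sum => t _; case/andP: (l_cap t) => _ /le_trans; apply.
    by rewrite /cap; case: ifP => // _; rewrite divr_ge0// mulr_ge0// ltW.
  by rewrite -mulr_suml ler_pdivrMr ?mulr_gt0// mulrA divfK ?gt_eqF//; exact: E_sparse.
apply: le_trans (wvariance_le_sparse (K := L ^+ 2) (a := fun t => 8 * L ^+ 2 * r t ^+ 2)
  l_ge0 l1 _ degree _) _; first by move=> t; rewrite !mulr_ge0 ?sqr_ge0.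
  by move=> s t /noncentral sN /noncentral tN; exact: noncentral_sqdist_le.
rewrite [leRHS](_ : _ = L ^+ 2 * (\sum_t l t * r t ^+ 2) +
    alpha / beta * (\sum_t l t * (8 * L ^+ 2 * r t ^+ 2))).
  by rewrite lerD2r ler_wpM2l ?sqr_ge0// wvariance_le.
by rewrite !mulr_sumr -big_split/=; apply: eq_bigr => t _; ring.
Qed.

Lemma robust_one_point_extension : exists c' : 'rV[R]_m,
  weight w (fun t => L ^+ 2 * (1 + 8 * (alpha / beta)) * r t ^+ 2 <
                     enorm (y t - c') ^+ 2) <= (2 * alpha + beta) * W.
Proof.
have cap_ge0 t : 0 <= cap t.
  by rewrite /cap; case: ifP => // _; rewrite divr_ge0// mulr_ge0// ltW.
have [c' cap_le1] := exists_robust_center cap_ge0 capped_wvariance_le.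
exists c'; set V := fun t => _ in cap_le1 *.
have V_noncentral : weight w (predD V central) <= beta * W.
  rewrite -[leRHS]mul1r -ler_pdivrMr ?mulr_gt0//; apply: le_trans cap_le1.
  rewrite /weight mulr_suml [leRHS](bigID central)/= [X in _ <= X + _]big1 ?add0r.
    rewrite (eq_bigl (fun t => V t && ~~ central t)) => [|t]; last exact: andbC.
    by apply: ler_sum => t /andP[_ /negbTE tN]; rewrite /cap tN.
  by move=> t /andP[_ tc]; rewrite /cap tc.
have central_le : weight w central <= 2 * alpha * W.
  by apply: weight_lower_tail => //; rewrite !mulr_ge0// ltW.
apply: (@le_trans _ _ (weight w (predU central (predD V central)))).
  by apply: le_weight => // t Vt; rewrite /= Vt andbT orbN.
by apply: le_trans (weightU w_ge0 _ _) _; rewrite mulrDl lerD.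
Qed.

End RobustExtension.

Section PowerInequalities.
Variable R : realType.
Implicit Types a b p t : R.

Lemma powR_convex_le p t a b : 1 <= p -> 0 <= t <= 1 -> 0 <= a -> 0 <= b ->
  ((1 - t) * a + t * b) `^ p <= (1 - t) * a `^ p + t * b `^ p.
Proof.
move=> p_ge1 /andP[t0 t1] a0 b0.
have := @convex_powR R p p_ge1 (Itv01 t0 t1) b a.
rewrite !inE/= !in_itv/= !andbT => /(_ b0 a0) conv.
by rewrite addrC [leRHS]addrC; exact: conv.
Qed.

Lemma powRD_le p t a b : 1 <= p -> 0 < t < 1 -> 0 <= a -> 0 <= b ->
  (a + b) `^ p <= (a / (1 - t)) `^ p + t / t `^ p * b `^ p.
Proof.
move=> p_ge1 /andP[t0 t1] a0 b0; have t1' : 0 < 1 - t by rewrite subr_gt0.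
have -> : a + b = (1 - t) * (a / (1 - t)) + t * (b / t) by field; rewrite !gt_eqF.
have a'0 : 0 <= a / (1 - t) by rewrite divr_ge0// ltW.
have b'0 : 0 <= b / t by rewrite divr_ge0// ltW.
apply: (le_trans (powR_convex_le p_ge1 _ a'0 b'0)); first by rewrite !ltW.
apply: lerD; first by rewrite ler_piMl ?powR_ge0// gerBl ltW.
rewrite -{2}[b](divfK (lt0r_neq0 t0)) (powRM p b'0 (ltW t0)).
by rewrite [_ * t `^ p]mulrC mulrA divfK// gt_eqF// powR_gt0.
Qed.

Lemma mulr_powR_root p a : 0 <= a -> 0 < p + 1 ->
  a `^ (1 / (p + 1)) * (a `^ (1 / (p + 1))) `^ p = a.
Proof.
move=> a_ge0 p1_gt0; rewrite -[X in _ * _ `^ X](addrK 1) mulr_powRB1 ?powR_ge0//.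
by rewrite -powRrM divfK ?gt_eqF// powRr1.
Qed.

Lemma powR_root_le p a b : 0 < p -> 0 <= a -> 0 < b -> a <= 1 / b `^ p ->
  a `^ (1 / p) <= 1 / b.
Proof.
move=> p_gt0 a_ge0 b_gt0 a_le; have inv_ge0 : 0 <= 1 / b by rewrite divr_ge0// ltW.
have powK : ((1 / b) `^ p) `^ (1 / p) = 1 / b.
  by rewrite -powRrM [p * _]mulrC divfK ?gt_eqF// powRr1.
rewrite -powK; apply: ge0_ler_powR; rewrite ?nnegrE ?powR_ge0 ?divr_ge0 ?(ltW p_gt0)//.
apply: (le_trans a_le); rewrite ler_pdivrMr ?powR_gt0// -powRM ?(ltW b_gt0)//.
by rewrite divfK ?gt_eqF// powR1.
Qed.

End PowerInequalities.

Section CostAt.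
Variables (R : realType) (T : finType) (n : nat) (p : R) (w : T -> R).
Hypothesis w_ge0 : forall t, 0 <= w t.
Implicit Types (x : T -> 'rV[R]_n) (c : 'rV[R]_n).

Lemma cost_at_ge0 x c : 0 <= cost_at p w x c.
Proof. by apply: sumr_ge0 => t _; rewrite mulr_ge0 ?powR_ge0. Qed.

Lemma cost_le_cost_at x c : 1 <= p -> cost p w x <= cost_at p w x c.
Proof. by move=> p_ge1; have [c0 ->] := cost_attained x p_ge1 w_ge0; exact. Qed.

Lemma cost_weightless x : 1 <= p -> weight w predT = 0 -> cost p w x = 0.
Proof.
move=> p_ge1 /psumr_eq0P w0; have [c -> _] := cost_attained x p_ge1 w_ge0.
by apply: big1 => t _; rewrite w0 ?mul0r.
Qed.

Lemma cost_ge0 x : 1 <= p -> 0 <= cost p w x.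
Proof.
by move=> p_ge1; have [c -> _] := cost_attained x p_ge1 w_ge0; exact: cost_at_ge0.
Qed.

End CostAt.

Section SparseCost.
Variables (R : realType) (T : finType) (d m : nat) (p : R).
Variables (x : T -> 'rV[R]_d) (y : T -> 'rV[R]_m) (w : T -> R).
Variables (E : rel T) (L : R).
Hypotheses (p_ge1 : 1 <= p) (w_ge0 : forall t, 0 <= w t) (L_ge0 : 0 <= L).
Hypothesis E_sym : symmetric E.
Hypothesis y_lipschitz : lipschitz_off E L x y.

Let W : R := weight w predT.

Lemma cost_at_le_exceptional c c' (bad : pred T) (k K : R) :
  (forall t, enorm (y t - c') `^ p <=
     k * enorm (x t - c) `^ p + if bad t then K else 0) ->
  cost_at p w y c' <= k * cost_at p w x c + K * weight w bad.
Proof.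
move=> dist_le; rewrite /cost_at /weight !mulr_sumr.
rewrite [X in _ + X]big_mkcond -big_split/=; apply: ler_sum => t _.
by have := ler_wpM2l (w_ge0 t) (dist_le t); case: (bad t); lra.
Qed.

Lemma dist_good_neighbour_le c c' (bad : pred T) (k : R) t :
  0 < W -> weight w bad + weight w (E t) <= W / 2 ->
  (forall u, ~~ bad u -> enorm (y u - c') <= L * (k * enorm (x u - c))) ->
  exists2 u, enorm (x u - c) `^ p <= cost_at p w x c / (W / 2) &
    enorm (y t - c') <= L * (enorm (x t - c) + (1 + k) * enorm (x u - c)).
Proof.
move=> W_gt0 bad_or_distorted good.
have [u] : exists2 u, predC (predU bad (E t)) u &
    enorm (x u - c) `^ p <= cost_at p w x c / (W / 2).
  apply: (le_average_ex w_ge0) => [u|]; first exact: powR_ge0.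
  have := weightC w (predU bad (E t)); have := weightU w_ge0 bad (E t).
  by rewrite -/W divr_gt0//=; lra.
rewrite /= negb_or => /andP[/good u_good /y_lipschitz tu] u_near; exists u => //.
have := ler_enorm_distD (y u) (y t) c'.
have := ler_wpM2l L_ge0 (ler_enorm_distD c (x t) (x u)).
by rewrite (enorm_distC c); lra.
Qed.

Section FixedSparsity.
Variables (c : 'rV[R]_d) (th : R).
Hypotheses (W_gt0 : 0 < W) (th_gt0 : 0 < th) (th_le : th <= 1 / 10).
Hypothesis E_sparse : everywhere_sparse w (th * th `^ p) E.

Let b_gt0 : 0 < th `^ p. Proof. exact: powR_gt0. Qed.

Let b_le : th `^ p <= 1 / 10.
Proof.
apply: le_trans th_le; apply: ge1r_powR => //.
by rewrite th_gt0/=; move: th_le; lra.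
Qed.

Let r (t : T) : R := enorm (x t - c).
Let r_ge0 t : 0 <= r t. Proof. exact: enorm_ge0. Qed.

Definition stretched c' : pred T :=
  fun t => L * ((1 + 4 * th) * enorm (x t - c)) < enorm (y t - c').

Lemma few_stretched_center : exists c', weight w (stretched c') <= 2 * th `^ p * W.
Proof.
have [c' weight_le] := robust_one_point_extension E_sym c w_ge0 W_gt0 L_ge0 b_gt0
  E_sparse y_lipschitz.
exists c'; apply: le_trans (_ : (2 * (th * th `^ p) + th `^ p) * W <= _); last first.
  rewrite ler_wpM2r ?(ltW W_gt0)//.
  by move: (ler_wpM2r (ltW b_gt0) th_le) b_gt0; lra.
apply: le_trans weight_le; apply: le_weight => // t; apply: contraTT.
rewrite mulfK ?gt_eqF// /stretched -!leNgt => sqdist_le.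
rewrite -(@ler_pXn2r _ 2)// ?nnegrE ?enorm_ge0//; last first.
  by rewrite !mulr_ge0 ?enorm_ge0//; move: th_gt0; lra.
apply: (le_trans sqdist_le); rewrite mulrA !exprMn ler_wpM2r ?sqr_ge0//.
by rewrite ler_wpM2l ?sqr_ge0//; move: th_gt0 th_le; nra.
Qed.

Variable c' : 'rV[R]_m.
Hypothesis few_stretched : weight w (stretched c') <= 2 * th `^ p * W.

Lemma dist_close_point_le t :
  exists2 u, r u `^ p <= cost_at p w x c / (W / 2) &
    enorm (y t - c') <= L * (r t + 3 * r u).
Proof.
have bW_ge0 : 0 <= th `^ p * W by rewrite mulr_ge0 ?ltW.
have [|u|u u_close t_le] := @dist_good_neighbour_le c c' (stretched c')
    (1 + 4 * th) t W_gt0.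
- have := E_sparse t; rewrite -/(weight w _) -/(weight w predT) -/W => degree.
  have := ler_wpM2r (ltW W_gt0) b_le; have := ler_wpM2r bW_ge0 th_le.
  by move: few_stretched; lra.
- by rewrite -leNgt.
- exists u => //; apply: (le_trans t_le).
  rewrite ler_wpM2l// lerD2l ler_wpM2r ?enorm_ge0//.
  by move: th_le; lra.
Qed.

Let far_cost : R := th / th `^ p * (3 `^ p * (cost_at p w x c / (W / 2))).

Lemma dist_powR_le t : enorm (y t - c') `^ p <=
  L `^ p * (1 + 4 * th) `^ p * r t `^ p +
    if stretched c' t then L `^ p * far_cost else 0.
Proof.
have p_ge0 : 0 <= p by exact: le_trans p_ge1.
have k_ge0 : 0 <= 1 + 4 * th by move: th_gt0; lra.
case: ifPn => [_|]; last first.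
  rewrite /stretched -leNgt addr0 => t_le; rewrite -!powRM ?mulr_ge0// -mulrA.
  by apply: ge0_ler_powR; rewrite ?nnegrE ?mulr_ge0 ?enorm_ge0.
have [u u_close t_le] := dist_close_point_le t.
apply: (@le_trans _ _ ((L * (r t + 3 * r u)) `^ p)).
  by apply: ge0_ler_powR; rewrite ?nnegrE ?mulr_ge0 ?addr_ge0 ?mulr_ge0 ?enorm_ge0.
rewrite powRM ?addr_ge0 ?mulr_ge0// -mulrA -mulrDr ler_wpM2l ?powR_ge0//.
have th_lt1 : 0 < 1 - th by move: th_le; lra.
have inv_le : (1 - th)^-1 <= 1 + 4 * th.
  by rewrite -div1r ler_pdivrMr//; move: th_gt0 th_le; nra.
have th_in01 : 0 < th < 1 by rewrite th_gt0 -subr_gt0.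
apply: (le_trans (powRD_le p_ge1 th_in01 _ _)); rewrite ?mulr_ge0//.
apply: lerD.
  rewrite -powRM//; apply: ge0_ler_powR => //; rewrite ?nnegrE.
  - by rewrite divr_ge0// ltW.
  - exact: mulr_ge0.
  - by rewrite mulrC ler_wpM2r.
rewrite ler_wpM2l ?divr_ge0 ?powR_ge0 ?(ltW th_gt0)//.
by rewrite powRM// ler_wpM2l ?powR_ge0.
Qed.

Lemma cost_at_le_few_stretched :
  cost_at p w y c' <= L `^ p * (1 + 6 * 3 `^ p * th) * cost_at p w x c.
Proof.
set C := cost_at p w x c; have C_ge0 : 0 <= C by exact: cost_at_ge0.
have near_le : (1 + 4 * th) `^ p <= 1 + 2 * 3 `^ p * th.
  have -> : 1 + 4 * th = (1 - 2 * th) * 1 + 2 * th * 3 by ring.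
  apply: le_trans (powR_convex_le p_ge1 _ _ _) _ => //.
    by move: th_gt0 th_le; lra.
  by rewrite powR1; move: th_gt0; lra.
have far_cost_ge0 : 0 <= far_cost.
  by rewrite !mulr_ge0 ?invr_ge0 ?mulr_ge0 ?powR_ge0// ltW.
have far_le : far_cost * weight w (stretched c') <= 4 * 3 `^ p * th * C.
  rewrite (_ : 4 * 3 `^ p * th * C = far_cost * (2 * th `^ p * W)) ?ler_wpM2l//.
  by rewrite /far_cost -/C; field; rewrite !gt_eqF.
have total_le : (1 + 4 * th) `^ p * C + far_cost * weight w (stretched c') <=
    (1 + 6 * 3 `^ p * th) * C by have := ler_wpM2r C_ge0 near_le; lra.
apply: (le_trans (cost_at_le_exceptional dist_powR_le)).
by rewrite -/C; have := ler_wpM2l (powR_ge0 L p) total_le; lra.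
Qed.

End FixedSparsity.

Lemma cost_le_sparse_power (th : R) : 0 < W -> 0 < th -> th <= 1 / 10 ->
  everywhere_sparse w (th * th `^ p) E ->
  cost p w y <= L `^ p * (1 + 6 * 3 `^ p * th) * cost p w x.
Proof.
move=> W_gt0 th_gt0 th_le E_sparse; have [c -> _] := cost_attained x p_ge1 w_ge0.
have [c' few_stretched] := few_stretched_center c W_gt0 th_gt0 th_le E_sparse.
apply: le_trans (cost_le_cost_at w_ge0 _ c' p_ge1) _.
exact: cost_at_le_few_stretched.
Qed.

Lemma cost_le_sparse (alpha : R) :
  everywhere_sparse w alpha E -> alpha <= 1 / 10 `^ (p + 1) ->
  cost p w y <= L `^ p * (1 + 3 `^ (p + 2) * alpha `^ (1 / (p + 1))) * cost p w x.
Proof.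
move=> sparse alpha_le; have [W0|W_neq0] := eqVneq W 0.
  by rewrite !cost_weightless// mulr0.
have W_gt0 : 0 < W by rewrite lt_def W_neq0 weight_ge0.
have alpha_ge0 : 0 <= alpha by exact: everywhere_sparse_ge0 sparse.
have p1_gt0 : 0 < p + 1 by move: p_ge1; lra.
have [alpha0|alpha_neq0] := eqVneq alpha 0.
  rewrite alpha0 powR0 ?mulr0 ?addr0 ?mulr1; last by rewrite gt_eqF ?divr_gt0.
  apply: (ler_small_perturbation (k := L `^ p * (6 * 3 `^ p) * cost p w x)
    (M := 1 / 10)) => // th /andP[th_gt0 th_le].
  apply: le_trans (cost_le_sparse_power W_gt0 th_gt0 th_le _) _; last by lra.
  by apply: everywhere_sparse_le sparse => //; rewrite alpha0 mulr_ge0 ?powR_ge0 ?ltW.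
have root_gt0 : 0 < alpha `^ (1 / (p + 1)).
  by rewrite powR_gt0// lt_def alpha_neq0.
apply: le_trans (cost_le_sparse_power W_gt0 root_gt0 _ _) _.
- exact: powR_root_le.
- by rewrite mulr_powR_root// ltrDr.
- rewrite ler_wpM2r ?cost_ge0// ler_wpM2l ?powR_ge0// lerD2l ler_wpM2r ?powR_ge0//.
  rewrite powRD ?(pnatr_eq0 R 3) ?implybT// -[2]/(2%:R) powR_mulrn//.
  by have := powR_ge0 3 p; lra.
Qed.

End SparseCost.

Section DistortionGraph.
Variables (R : realType) (T : finType) (d m : nat) (eps : R).
Variables (x : T -> 'rV[R]_d) (y : T -> 'rV[R]_m).

Lemma distortion_graph_sym : symmetric (distortion_graph eps x y).
Proof.
by move=> s t; rewrite /distortion_graph (enorm_distC (x s)) (enorm_distC (y s)).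
Qed.

Lemma distortion_graph_lipschitz :
  lipschitz_off (distortion_graph eps x y) (1 + eps) x y.
Proof. by move=> s t; rewrite negbK => /andP[]. Qed.

Lemma distortion_graph_colipschitz : 0 < 1 + eps ->
  lipschitz_off (distortion_graph eps x y) (1 + eps) y x.
Proof. by move=> eps1 s t; rewrite negbK => /andP[+ _]; rewrite ler_pdivrMl. Qed.

End DistortionGraph.

Theorem theorem13 (R : realType) (d m : nat) (p eps alpha : R)
    (X : {fset 'rV[R]_d}) (w : X -> R) (phi : X -> 'rV[R]_m) :
  1 <= p ->
  0 < eps ->
  (forall x : X, 0 <= w x) ->
  everywhere_sparse w alpha (distortion_graph eps (fun x : X => val x) phi) ->
  alpha <= 1 / 10 `^ (p + 1) ->
  let D := (1 + eps) `^ p * (1 + 3 `^ (p + 2) * alpha `^ (1 / (p + 1))) in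
  1 / D * cost p w (fun x : X => val x) <= cost p w phi /\
  cost p w phi <= D * cost p w (fun x : X => val x).
Proof.
move=> p_ge1 eps_gt0 w_ge0 sparse alpha_le D.
have L_gt0 : 0 < 1 + eps by rewrite addr_gt0.
have D_gt0 : 0 < D by rewrite mulr_gt0 ?powR_gt0// ltr_pwDl// mulr_ge0 ?powR_ge0.
have G_sym := distortion_graph_sym eps (fun x : X => val x) phi.
split.
- rewrite div1r ler_pdivrMl//.
  apply: (cost_le_sparse p_ge1 w_ge0 (ltW L_gt0) G_sym _ sparse alpha_le).
  exact: distortion_graph_colipschitz.
- apply: (cost_le_sparse p_ge1 w_ge0 (ltW L_gt0) G_sym _ sparse alpha_le).
  exact: distortion_graph_lipschitz.
Qed.
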